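(* Let $m\ge 2$, $n\ge 1$ and let $\mathcal{A}\in T_{m,n}$ be a strictly semi-positive tensor. Then: (i) $\beta(\mathcal{A})\le\delta_{H^+}(\mathcal{A})$; (ii) $\beta(\mathcal{A})\le n^{\frac{m-2}{2}}\delta_{Z^+}(\mathcal{A})$ if $m$ is even.
   Context: $T_{m,n}$ is the set of real tensors $\mathcal{A}=(a_{i_1\cdots i_m})$ of order $m$ and dimension $n$, with indices in $I_n=\{1,\dots,n\}$ and no symmetry assumed. For $x\in\mathbb{R}^n$, $\mathcal{A}x^{m-1}\in\mathbb{R}^n$ has components $(\mathcal{A}x^{m-1})_i=\sum_{i_2,\dots,i_m=1}^n a_{ii_2\cdots i_m}x_{i_2}\cdots x_{i_m}$, and $x^{[m-1]}=(x_1^{m-1},\dots,x_n^{m-1})^\top$. Inequalities between vectors are componentwise. $\mathcal{A}$ is strictly semi-positive if for each $x\ge 0$, $x\ne 0$, there is $k\in I_n$ with $x_k>0$ and $(\mathcal{A}x^{m-1})_k>0$. $\beta(\mathcal{A}):=\min_{x\ge 0,\ \|x\|_\infty=1}\ \max_{i\in I_n}x_i(\mathcal{A}x^{m-1})_i$, where $\|x\|_\infty=\max_i|x_i|$. For nonempty $J\subset I_n$ with $|J|=r$, the principal sub-tensor $\mathcal{A}^J_r\in T_{m,r}$ is the tensor with entries $a_{i_1\cdots i_m}$, $i_1,\dots,i_m\in J$. A real number $\lambda$ is an $H^+$-eigenvalue of $\mathcal{A}$ if there is a nonzero $x\in\mathbb{R}^n$, $x\ge 0$, with $\mathcal{A}x^{m-1}=\lambda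 x^{[m-1]}$; it is a $Z^+$-eigenvalue of $\mathcal{A}$ if there is $x\in\mathbb{R}^n$, $x\ge 0$, with $x^\top x=1$ and $\mathcal{A}x^{m-1}=\lambda x$. $\lambda_{H^+}(\mathcal{A})$ and $\lambda_{Z^+}(\mathcal{A})$ denote the smallest $H^+$-eigenvalue and the smallest $Z^+$-eigenvalue of $\mathcal{A}$ (if any exists). Then $\delta_{H^+}(\mathcal{A}):=\min\lambda_{H^+}(\mathcal{A}^J_r)$ and $\delta_{Z^+}(\mathcal{A}):=\min\lambda_{Z^+}(\mathcal{A}^J_r)$, where the minimum is over all nonempty $J\subset I_n$ ($r=|J|$) for which $\mathcal{A}^J_r$ has at least one $H^+$-eigenvalue (resp. $Z^+$-eigenvalue). *)

(* Defs.v *)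
From mathcomp Require Import all_boot all_order all_algebra.
From mathcomp Require Import all_classical all_reals all_analysis.
Import Order.TTheory GRing.Theory Num.Theory numFieldNormedType.Exports.

Set Implicit Arguments.
Unset Strict Implicit.
Unset Printing Implicit Defensive.

Local Open Scope classical_set_scope.
Local Open Scope ring_scope.

(* Indices run over 'I_n = {0, ..., n-1}; a vector of R^n is a row vector. *)
Definition tensor (R : Type) (m n : nat) := m.-tuple 'I_n -> R.

(* [enum_val] is the increasing bijection from 'I_#|J| to J. *)
Definition principal_subtensor (R : Type) m n (A : tensor R m n)
    (J : {set 'I_n}) : tensor R m #|J| :=
  fun t => A (map_tuple (@enum_val _ (mem J)) t).
Arguments principal_subtensor {R m n} A J t.

Section Tensor.
Variable R : realType.
Implicit Types m n : nat.

(* The multi-index t = (i_1, ..., i_m) has i_1 = i, and [behead t] lists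
   i_2, ..., i_m. *)
Definition tensor_app m n (A : tensor R m n) (x : 'rV[R]_n) : 'rV[R]_n :=
  \row_i \sum_(t : m.-tuple 'I_n | ohead t == Some i)
            A t * \prod_(j <- behead t) x 0 j.

Definition vpow n (x : 'rV[R]_n) (k : nat) : 'rV[R]_n := \row_i x 0 i ^+ k.

Definition nonneg n (x : 'rV[R]_n) := forall i, 0 <= x 0 i.

Definition strictly_semi_positive m n (A : tensor R m n) :=
  forall x : 'rV[R]_n, nonneg x -> x != 0 ->
    exists k, 0 < x 0 k /\ 0 < tensor_app A x 0 k.

Definition max_prod m n (A : tensor R m n) (x : 'rV[R]_n) : R :=
  sup [set x 0 i * tensor_app A x 0 i | i in [set: 'I_n]].

(* On matrices, [`|x|] is the maximum of the absolute values of the entries. *)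
Definition inf_sphere_nonneg n : set 'rV[R]_n :=
  [set x | nonneg x /\ `|x| = 1].

(* Minima and maxima over sets of reals are rendered by [inf] and [sup]; the
   lemmas [max_prod_attained], [beta_attained], [lambda_Hplus_attained],
   [lambda_Zplus_attained], [delta_Hplus_attained] and [delta_Zplus_attained]
   below show that they are attained. *)
Definition beta m n (A : tensor R m n) : R :=
  inf [set max_prod A x | x in @inf_sphere_nonneg n].

Definition Hplus_eigenvalue m n (A : tensor R m n) : set R :=
  [set lambda | exists x : 'rV[R]_n,
     [/\ x != 0, nonneg x & tensor_app A x = lambda *: vpow x m.-1]].

Definition Zplus_eigenvalue m n (A : tensor R m n) : set R :=
  [set lambda | exists x : 'rV[R]_n,
     [/\ nonneg x, x *m x^T = 1%:M & tensor_app A x = lambda *: x]].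

Definition lambda_Hplus m n (A : tensor R m n) : R := inf (Hplus_eigenvalue A).

Definition lambda_Zplus m n (A : tensor R m n) : R := inf (Zplus_eigenvalue A).

Definition delta_Hplus m n (A : tensor R m n) : R :=
  inf [set lambda_Hplus (principal_subtensor A J) | J in
        [set J : {set 'I_n} | J != finset.set0 /\
           Hplus_eigenvalue (principal_subtensor A J) !=set0]].

Definition delta_Zplus m n (A : tensor R m n) : R :=
  inf [set lambda_Zplus (principal_subtensor A J) | J in
        [set J : {set 'I_n} | J != finset.set0 /\
           Zplus_eigenvalue (principal_subtensor A J) !=set0]].

End Tensor.

Section Attained.
Variable R : realType.
Implicit Types m n : nat.

Let inf_min (S : set R) b : S b -> lbound S b -> inf S = b.
Proof.
move=> Sb lb; apply/eqP; rewrite eq_le; apply/andP; split.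
  by apply: ge_inf => //; exists b.
by apply: lb_le_inf => //; exists b.
Qed.

Let sup_max (S : set R) b : S b -> ubound S b -> sup S = b.
Proof.
move=> Sb ub; apply/eqP; rewrite eq_le; apply/andP; split.
  by apply: ge_sup => //; exists b.
by apply: ub_le_sup => //; exists b.
Qed.

Let sum_cont (T : topologicalType) I (r : seq I) (P : pred I) (F : I -> T -> R) :
  (forall i, P i -> continuous (F i)) ->
  continuous (fun x => \sum_(i <- r | P i) F i x).
Proof.
have addC : continuous (fun z : R * R => z.1 + z.2) by exact: add_continuous.
exact: (continuous_big addC).
Qed.

Let prod_cont (T : topologicalType) I (r : seq I) (P : pred I) (F : I -> T -> R) :
  (forall i, P i -> continuous (F i)) ->
  continuous (fun x => \prod_(i <- r | P i) F i x).
Proof.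
have mulC : continuous (fun z : R * R => z.1 * z.2) by exact: mul_continuous.
exact: (continuous_big mulC).
Qed.

Let mul_cont (T : topologicalType) (f g : T -> R) :
  continuous f -> continuous g -> continuous (fun x => f x * g x).
Proof. by move=> cf cg x; apply: cvgM; [exact: cf|exact: cg]. Qed.

Let sub_cont (T : topologicalType) (f g : T -> R) :
  continuous f -> continuous g -> continuous (fun x => f x - g x).
Proof. by move=> cf cg x; apply: cvgB; [exact: cf|exact: cg]. Qed.

Let cst_cont (T : topologicalType) (c : R) : continuous (fun _ : T => c).
Proof. by move=> x; exact: cvg_cst. Qed.

Let coord_cont n i : continuous (fun x : 'rV[R]_n => x 0 i).
Proof. exact: coord_continuous. Qed.

Let tensor_app_continuous m n (A : tensor R m n) i :
  continuous (fun x : 'rV[R]_n => tensor_app A x 0 i).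
Proof.
have -> : (fun x : 'rV[R]_n => tensor_app A x 0 i) =
    fun x => \sum_(t : m.-tuple 'I_n | ohead t == Some i)
               A t * \prod_(j <- behead t) x 0 j.
  by apply/funext => x; rewrite mxE.
apply: sum_cont => t _; apply: mul_cont; first exact: cst_cont.
by apply: prod_cont => j _; exact: coord_cont.
Qed.

Lemma max_prod_attained m n (A : tensor R m n) (x : 'rV[R]_n) : (0 < n)%N ->
  exists2 i, max_prod A x = x 0 i * tensor_app A x 0 i &
    forall j, x 0 j * tensor_app A x 0 j <= max_prod A x.
Proof.
move=> n0.
have [i _ imax] := @Order.TotalTheory.arg_maxP _ _ _ (Ordinal n0) xpredT
  (fun i => x 0 i * tensor_app A x 0 i) isT.
have E : max_prod A x = x 0 i * tensor_app A x 0 i.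
  apply: sup_max; first by exists i.
  by move=> _ [j _ <-]; exact: imax.
by exists i => // j; rewrite E; exact: imax.
Qed.

Let max_prod_continuous m n (A : tensor R m n) : (0 < n)%N ->
  continuous (max_prod A).
Proof.
move=> n0; pose F (i : 'I_n) (x : 'rV[R]_n) : R := x 0 i * tensor_app A x 0 i.
have cF i : continuous (F i).
  apply: mul_cont; first exact: coord_cont.
  exact: tensor_app_continuous.
pose G (s : seq 'I_n) x := foldr (fun i a => Num.max (F i x) a) (F (Ordinal n0) x) s.
have cG s : continuous (G s).
  elim: s => [|i s IH]; first exact: cF.
  move=> x; apply: continuous_max; [exact: cF|exact: IH].
suff -> : max_prod A = G (enum 'I_n) by exact: cG.
apply/funext => x; have [i Ei imax] := max_prod_attained A x n0.
apply/eqP; rewrite eq_le; apply/andP; split.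
  have : i \in enum 'I_n by rewrite mem_enum.
  rewrite /G Ei; elim: (enum 'I_n) => //= j s IH.
  by rewrite inE le_max => /orP[/eqP <-|/IH ->]; rewrite ?lexx ?orbT.
rewrite /G; elim: (enum 'I_n) => /= [|j s IH]; first exact: imax.
by rewrite ge_max imax.
Qed.

Let nonneg_closed n : closed [set x : 'rV[R]_n | nonneg x].
Proof.
have -> : [set x : 'rV[R]_n | nonneg x] =
    \bigcap_(i in [set: 'I_n]) [set x | 0 <= x 0 i].
  by apply/seteqP; split => x xP i //=; exact: xP.
apply: closed_bigI => i _.
apply: (@preimage_closed _ _ (fun x : 'rV[R]_n => x 0 i) [set y | 0 <= y]).
  by move=> x _; exact: coord_cont.
exact: closed_ge.
Qed.

Let eqfun_closed n (f g : 'rV[R]_n -> R) : continuous f -> continuous g ->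
  closed [set x | f x = g x].
Proof.
move=> cf cg.
have -> : [set x | f x = g x] = (fun x => f x - g x) @^-1` [set y | y = 0].
  by apply/seteqP; split => x /= /eqP; rewrite ?subr_eq0 => /eqP // ->; rewrite subrr.
apply: preimage_closed; last exact: closed_eq.
move=> x _; exact: (sub_cont cf cg).
Qed.

Let le1_compact n (K : set 'rV[R]_n) : closed K ->
  (forall x, K x -> forall i, `|x 0 i| <= 1) -> compact K.
Proof.
move=> cK K1; apply: bounded_closed_compact => //.
exists 1; split => // M M1 x /K1 xP.
have M0 : 0 <= M by apply: le_trans (ltW M1).
rewrite /= [leLHS]/Num.norm /= mx_normrE; apply/bigmax_leP; split=> // -[i j] _ /=.
by rewrite ord1 (le_trans (xP j)) // ltW.
Qed.

Let norm_entry n (x : 'rV[R]_n) i : `|x 0 i| <= `|x|.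
Proof.
rewrite [leRHS]/Num.norm /= mx_normrE.
by apply: (@le_bigmax _ _ _ 0 (fun ij : 'I_1 * 'I_n => `|x ij.1 ij.2|) (0, i)).
Qed.

Lemma beta_attained m n (A : tensor R m n) : (0 < n)%N ->
  exists2 x, @inf_sphere_nonneg R n x & beta A = max_prod A x.
Proof.
move=> n0.
have S0 : @inf_sphere_nonneg R n !=set0.
  exists (const_mx 1); split; first by move=> i; rewrite mxE.
  apply/eqP; rewrite eq_le; apply/andP; split.
    rewrite [leLHS]/Num.norm /= mx_normrE; apply/bigmax_leP; split=> // -[i j] _ /=.
    by rewrite mxE normr1.
  by rewrite (le_trans _ (norm_entry _ (Ordinal n0))) // mxE normr1.
have cS : compact (@inf_sphere_nonneg R n).
  apply: le1_compact.
    apply: closedI; first exact: nonneg_closed.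
    apply: eqfun_closed; last exact: cst_cont.
    by move=> x; exact: norm_continuous.
  by move=> x [_ <-] i; exact: norm_entry.
have [x /set_mem xS xmin] := EVT_min_rV S0 cS
  (continuous_subspaceT (max_prod_continuous (A := A) n0)).
exists x => //; apply: inf_min; first by exists x.
by move=> _ [y yS <-]; apply: xmin; rewrite inE.
Qed.

Let eig_min n (K : set 'rV[R]_n) (f : 'rV[R]_n -> R) :
  closed K -> (forall x, K x -> forall i, `|x 0 i| <= 1) ->
  {within K, continuous f} -> K !=set0 ->
  exists2 x, K x & inf (f @` K) = f x.
Proof.
move=> cK K1 cf K0.
have [x /set_mem xS xmin] := EVT_min_rV K0 (le1_compact cK K1) cf.
exists x => //; apply: inf_min; first by exists x.
by move=> _ [y yS <-]; apply: xmin; rewrite inE.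
Qed.


Let tensor_appZ m n (A : tensor R m n) c (x : 'rV[R]_n) :
  tensor_app A (c *: x) = c ^+ m.-1 *: tensor_app A x.
Proof.
apply/rowP => i; rewrite !mxE mulr_sumr; apply: eq_bigr => t _.
rewrite mulrCA; congr (_ * _).
under eq_bigr do rewrite mxE.
by rewrite big_split /= big_const_seq count_predT size_behead size_tuple iter_mulr_1.
Qed.

Let nonneg_sum_gt0 n (x : 'rV[R]_n) k : nonneg x -> x != 0 ->
  0 < \sum_i x 0 i ^+ k.
Proof.
move=> x0 xn0; rewrite lt_neqAle sumr_ge0 ?andbT; last by move=> i _; exact: exprn_ge0.
apply: contraNN xn0; rewrite eq_sym psumr_eq0; last by move=> i _; exact: exprn_ge0.
move=> /allP h; apply/eqP/rowP => i; rewrite mxE.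
by have := h i (mem_index_enum i); rewrite /= expf_eq0 => /andP[_ /eqP].
Qed.

Let pow_cont (T : topologicalType) (f : T -> R) k :
  continuous f -> continuous (fun x => f x ^+ k).
Proof.
move=> cf; elim: k => [|k IH]; first exact: cst_cont.
rewrite (_ : (fun x => _) = fun x => f x * f x ^+ k); first exact: mul_cont.
by apply/funext => x; rewrite exprS.
Qed.

Lemma lambda_Hplus_attained m n (A : tensor R m n) :
  Hplus_eigenvalue A !=set0 -> Hplus_eigenvalue A (lambda_Hplus A).
Proof.
pose p (x : 'rV[R]_n) := \sum_i tensor_app A x 0 i.
pose s (x : 'rV[R]_n) := \sum_i x 0 i ^+ m.-1.
pose K1 := [set x : 'rV[R]_n | \sum_i x 0 i = 1].
pose K2 := [set x : 'rV[R]_n |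
  forall i, tensor_app A x 0 i * s x = p x * x 0 i ^+ m.-1].
pose K := [set x : 'rV[R]_n | nonneg x] `&` (K1 `&` K2).
pose f x := p x / s x.
have cp : continuous p by apply: sum_cont => i _; exact: tensor_app_continuous.
have cs : continuous s.
  by apply: sum_cont => i _; apply: pow_cont; exact: coord_cont.
have s0 x : K x -> s x != 0.
  move=> [x0 [x1 _]]; apply: lt0r_neq0; apply: nonneg_sum_gt0 => //.
  apply/eqP => x00; move: x1; rewrite /K1 /= x00.
  rewrite big1 => [/esym/eqP|i _]; last by rewrite mxE.
  by rewrite oner_eq0.
have E : Hplus_eigenvalue A = f @` K.
  apply/seteqP; split => [l [x [xn0 x0 Ax]]|_ [x Kx <-]].
    have S0 : 0 < \sum_i x 0 i by have := nonneg_sum_gt0 1 x0 xn0.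
    pose c := (\sum_i x 0 i)^-1.
    have Ay : tensor_app A (c *: x) = l *: vpow (c *: x) m.-1.
      rewrite tensor_appZ Ax; apply/rowP => i; rewrite !mxE exprMn.
      by rewrite mulrCA.
    have py : p (c *: x) = l * s (c *: x).
      by rewrite /p Ay mulr_sumr; apply: eq_bigr => i _; rewrite !mxE.
    have Ky : K (c *: x).
      split; first by move=> i; rewrite mxE mulr_ge0 // invr_ge0 ltW.
      split; last first.
        move=> i; rewrite py Ay [in X in X * _]mxE [in X in _ * X * _]mxE.
        by rewrite mulrAC.
      rewrite /K1 /=; under eq_bigr do rewrite mxE.
      by rewrite -mulr_sumr mulVf // gt_eqF.
    by exists (c *: x) => //; rewrite /f py mulfK // s0.
  have sx := s0 _ Kx; case: Kx => x0 [x1 xe]; exists x; split => //.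
    apply/eqP => x00; move: x1; rewrite /K1 /= x00.
    rewrite big1 => [/esym/eqP|i _]; last by rewrite mxE.
    by rewrite oner_eq0.
  by apply/rowP => i; rewrite [RHS]mxE [in X in _ = _ * X]mxE /f mulrAC -xe mulfK //.
move=> ne; rewrite /lambda_Hplus {2}E.
have [||||x Kx ->] := @eig_min n K f; last by rewrite E; exists x.
- apply: closedI; first exact: nonneg_closed.
  apply: closedI.
    apply: eqfun_closed; last exact: cst_cont.
    by apply: sum_cont => i _; exact: coord_cont.
  have -> : K2 = \bigcap_(i in [set: 'I_n])
      [set x | tensor_app A x 0 i * s x = p x * x 0 i ^+ m.-1].
    by apply/seteqP; split => x xP i //=; exact: xP.
  apply: closed_bigI => i _; apply: eqfun_closed.
    by apply: mul_cont => //; exact: tensor_app_continuous.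
  by apply: mul_cont => //; apply: pow_cont; exact: coord_cont.
- move=> x [x0 [x1 _]] i; rewrite ger0_norm // -x1 (bigD1 i) //= lerDl.
  by apply: sumr_ge0.
- rewrite continuous_subspace_in => x /set_mem Kx.
  apply: cvgM; first exact: (continuous_subspaceT cp).
  apply: cvgV; first exact: s0.
  exact: (continuous_subspaceT cs).
- by case: ne => l; rewrite E => -[x Kx _]; exists x.
Qed.

Lemma lambda_Zplus_attained m n (A : tensor R m n) :
  Zplus_eigenvalue A !=set0 -> Zplus_eigenvalue A (lambda_Zplus A).
Proof.
pose f (x : 'rV[R]_n) := \sum_i x 0 i * tensor_app A x 0 i.
pose K1 := [set x : 'rV[R]_n | \sum_i x 0 i ^+ 2 = 1].
pose K2 := [set x : 'rV[R]_n | forall i, tensor_app A x 0 i = f x * x 0 i].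
pose K := [set x : 'rV[R]_n | nonneg x] `&` (K1 `&` K2).
have cf : continuous f.
  apply: sum_cont => i _; apply: mul_cont; first exact: coord_cont.
  exact: tensor_app_continuous.
have K1E (x : 'rV[R]_n) : (x *m x^T = 1%:M) <-> \sum_i x 0 i ^+ 2 = 1.
  have xx : (x *m x^T) 0 0 = \sum_i x 0 i ^+ 2.
    by rewrite mxE; apply: eq_bigr => i _; rewrite mxE expr2.
  split => [h|h]; first by rewrite -xx h mxE.
  by apply/matrixP => i j; rewrite !ord1 xx h mxE.
have E : Zplus_eigenvalue A = f @` K.
  apply/seteqP; split => [l [x [x0 /K1E x1 Ax]]|_ [x [x0 [x1 xe]] <-]].
    have fx : f x = l.
      rewrite /f Ax -[RHS]mulr1 -x1 mulr_sumr; apply: eq_bigr => i _.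
      by rewrite mxE mulrCA expr2.
    by exists x => //; split => //; split => // i; rewrite fx Ax mxE.
  exists x; split => //; first exact/K1E.
  by apply/rowP => i; rewrite xe mxE.
move=> ne; rewrite /lambda_Zplus {2}E.
have [||||x Kx ->] := @eig_min n K f; last by rewrite E; exists x.
- apply: closedI; first exact: nonneg_closed.
  apply: closedI.
    apply: eqfun_closed; last exact: cst_cont.
    by apply: sum_cont => i _; apply: pow_cont; exact: coord_cont.
  have -> : K2 = \bigcap_(i in [set: 'I_n])
      [set x | tensor_app A x 0 i = f x * x 0 i].
    by apply/seteqP; split => x xP i //=; exact: xP.
  apply: closed_bigI => i _; apply: eqfun_closed.
    exact: tensor_app_continuous.
  by apply: mul_cont => //; exact: coord_cont.
- move=> x [x0 [x1 _]] i; rewrite ger0_norm //.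
  have : x 0 i ^+ 2 <= 1.
    rewrite -x1 (bigD1 i) //= lerDl; apply: sumr_ge0 => j _; exact: sqr_ge0.
  by rewrite expr_le1.
- exact: continuous_subspaceT.
- by case: ne => l; rewrite E => -[x Kx _]; exists x.
Qed.

Let finmin (T : finType) (S : set T) (F : T -> R) :
  S !=set0 -> exists2 J, S J & inf (F @` S) = F J.
Proof.
move=> [J0 SJ0].
have PJ0 : J0 \in S by rewrite inE.
have [J /set_mem SJ Jmin] := @Order.TotalTheory.arg_minP _ _ _ J0
  (fun J => J \in S) F PJ0.
exists J => //; apply: inf_min; first by exists J.
by move=> _ [J' SJ' <-]; apply: Jmin; rewrite inE.
Qed.

Let dim1 n (i : 'I_n) : forall k l : 'I_#|(finset.set1 i)|, k = l.
Proof.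
move=> k l; apply: val_inj => /=.
by case: k l => [[|k] hk] [[|l] hl] //=; rewrite cards1 in hk hl.
Qed.

Lemma delta_Hplus_attained m n (A : tensor R m n) : (0 < n)%N ->
  exists2 J : {set 'I_n},
    J != finset.set0 /\ Hplus_eigenvalue (principal_subtensor A J) !=set0 &
    delta_Hplus A = lambda_Hplus (principal_subtensor A J).
Proof.
move=> n0; apply: finmin; pose i0 := Ordinal n0; exists (finset.set1 i0); split.
  by apply/set0Pn; exists i0; rewrite inE.
set B := principal_subtensor _ _.
have k0 : 'I_#|(finset.set1 i0)| by rewrite cards1; exact: ord0.
exists (tensor_app B (const_mx 1) 0 k0), (const_mx 1); split.
- apply/eqP => /rowP /(_ k0); rewrite !mxE => /eqP; by rewrite oner_eq0.
- by move=> i; rewrite mxE.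
- apply/rowP => i; rewrite (dim1 i k0) [RHS]mxE [vpow _ _ _ _]mxE.
  by rewrite [const_mx _ _ _]mxE expr1n mulr1.
Qed.

Lemma delta_Zplus_attained m n (A : tensor R m n) : (0 < n)%N ->
  exists2 J : {set 'I_n},
    J != finset.set0 /\ Zplus_eigenvalue (principal_subtensor A J) !=set0 &
    delta_Zplus A = lambda_Zplus (principal_subtensor A J).
Proof.
move=> n0; apply: finmin; pose i0 := Ordinal n0; exists (finset.set1 i0); split.
  by apply/set0Pn; exists i0; rewrite inE.
set B := principal_subtensor _ _.
have k0 : 'I_#|(finset.set1 i0)| by rewrite cards1; exact: ord0.
exists (tensor_app B (const_mx 1) 0 k0), (const_mx 1); split.
- by move=> i; rewrite mxE.
- apply/matrixP => i j; rewrite !ord1 !mxE.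
  under eq_bigr do rewrite !mxE mulr1.
  by rewrite sumr_const card_ord cards1.
- apply/rowP => i; rewrite (dim1 i k0) [RHS]mxE.
  by rewrite [const_mx _ _ _]mxE mulr1.
Qed.

End Attained.

(* Main.v *)
Require Import Defs.
From mathcomp Require Import all_boot all_order all_algebra.
From mathcomp Require Import all_classical all_reals all_analysis.
Import Order.TTheory GRing.Theory Num.Theory numFieldNormedType.Exports.

(** Extend an eigenvector of a principal sub-tensor by zero to a vector [y] of
    R^n; then [y_i (A y^(m-1))_i] is [lambda y_i^m] (H-case) or [lambda y_i^2]
    (Z-case) on [J] and [0] elsewhere. By homogeneity [beta A * |y|_oo^m] is at
    most one of these numbers, hence at most [lambda |y|_oo^m], respectively
    [lambda |y|_oo^2], and in the Z-case [1 = |y|_2^2 <= n |y|_oo^2] finishes. *)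

Local Open Scope ring_scope.

Section Tensors.
Set Implicit Arguments.
Unset Strict Implicit.
Variables (R : realType) (m n : nat).
Implicit Types (A : tensor R m n) (J : {set 'I_n}) (y : 'rV[R]_n).

Lemma tensor_app_scale A (c : R) y :
  tensor_app A (c *: y) = c ^+ m.-1 *: tensor_app A y.
Proof.
apply/rowP => i; rewrite !mxE mulr_sumr; apply: eq_bigr => t _.
rewrite mulrCA; congr (_ * _); under eq_bigr do rewrite mxE.
by rewrite big_split /= big_const_seq count_predT size_behead size_tuple iter_mulr_1.
Qed.

Lemma ler_norm_coord y i : y 0 i <= `|y|.
Proof.
apply: (le_trans (ler_norm _)); rewrite [leRHS]/Num.norm /= mx_normrE.
by apply: (@le_bigmax _ _ _ 0 (fun ij : 'I_1 * 'I_n => `|y ij.1 ij.2|) (0, i)).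
Qed.

(** Since [enum_val] is injective, each sum has at most one term; this form avoids an inverse of
    [enum_val], which would require a membership proof. *)
Definition extend_zero J (x : 'rV[R]_#|J|) : 'rV[R]_n :=
  \row_i \sum_(k | @enum_val _ (mem J) k == i) x 0 k.

Lemma extend_zero_in J (x : 'rV[R]_#|J|) (k : 'I_#|J|) : extend_zero x 0 (enum_val k) = x 0 k.
Proof.
rewrite mxE (big_pred1 k) // => l /=.
by rewrite (inj_eq enum_val_inj).
Qed.

Lemma extend_zero_out J (x : 'rV[R]_#|J|) i : i \notin J -> extend_zero x 0 i = 0.
Proof.
move=> iJ; rewrite mxE big_pred0 // => k; apply: contraNF iJ => /eqP <-.
exact: enum_valP.
Qed.

Lemma extend_zero_nonneg J (x : 'rV[R]_#|J|) : nonneg x -> nonneg (extend_zero x).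
Proof. by move=> x0 i; rewrite mxE sumr_ge0. Qed.

Lemma extend_zero_neq0 J (x : 'rV[R]_#|J|) : x != 0 -> extend_zero x != 0.
Proof.
apply: contraNN => /eqP e; apply/eqP/rowP => k.
by rewrite -extend_zero_in e !mxE.
Qed.

(** A multi-index that leaves [J] contributes a zero factor; the others correspond bijectively,
    through [enum_val], to the multi-indices of the sub-tensor. *)
Lemma tensor_app_extend_zero A J (x : 'rV[R]_#|J|) (k : 'I_#|J|) :
  tensor_app A (extend_zero x) 0 (enum_val k) =
  tensor_app (principal_subtensor A J) x 0 k.
Proof.
pose kJ : enum_val k \in J := enum_valP k.
rewrite !mxE (bigID (fun t : m.-tuple 'I_n => all (mem J) t)) /=.
rewrite [X in _ + X]big1 ?addr0; last first.
  move=> t /andP[ht /allPn[j jt jJ]].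
  (* The head of [t] is [enum_val k], which lies in [J], so the offending [j] sits in the tail, the
     only part the product runs over. *)
  have jb : j \in behead t.
    case: t ht jt => -[|i s] //= _ /eqP[->]; rewrite inE => /predU1P[ji|//].
    by move: jJ; rewrite ji /= kJ.
  by rewrite (big_rem j) //= extend_zero_out // mul0r mulr0.
rewrite (reindex_onto (map_tuple (@enum_val _ (mem J)))
                      (map_tuple (enum_rank_in kJ))) /=; last first.
  move=> t /andP[_ /allP tJ]; apply: val_inj => /=.
  rewrite -map_comp map_id_in // => i /tJ iJ /=.
  by rewrite enum_rankK_in.
apply: eq_big => [t|t _].
  rewrite -[RHS]andbT -[X in _ = X && _]andbT; congr (_ && _ && _).
  - case: t => -[|i s] //= _.
    by rewrite !(inj_eq Some_inj) (inj_eq enum_val_inj).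
  - by apply/allP => _ /mapP[i _ ->]; exact: enum_valP.
  - apply/eqP/val_inj => /=; rewrite -map_comp map_id_in // => i _ /=.
    exact: enum_valK_in.
congr (_ * _); rewrite behead_map big_map.
by apply: eq_bigr => j _; rewrite extend_zero_in.
Qed.

Lemma extend_zero_prod A J (x : 'rV[R]_#|J|) i :
  extend_zero x 0 i * tensor_app A (extend_zero x) 0 i = 0 \/
  exists2 k : 'I_#|J|, i = enum_val k &
    extend_zero x 0 i * tensor_app A (extend_zero x) 0 i =
    x 0 k * tensor_app (principal_subtensor A J) x 0 k.
Proof.
have [iJ|iJ] := boolP (i \in J); last by left; rewrite extend_zero_out ?mul0r.
right; exists (enum_rank_in iJ i); first by rewrite enum_rankK_in.
rewrite -tensor_app_extend_zero -[in RHS]extend_zero_in.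
by rewrite enum_rankK_in.
Qed.

(** The index provided for the zero extension has a positive product, so it must come from [J]. *)
Lemma strictly_semi_positive_sub A J :
  strictly_semi_positive A -> strictly_semi_positive (principal_subtensor A J).
Proof.
move=> hA x x0 xn0.
have [i [yi Ai]] := hA _ (extend_zero_nonneg x0) (extend_zero_neq0 xn0).
have [e|[k ik _]] := extend_zero_prod A x i.
  by have := mulr_gt0 yi Ai; rewrite e ltxx.
exists k; split; first by rewrite -extend_zero_in -ik.
by rewrite -tensor_app_extend_zero -ik.
Qed.

Lemma max_prod_gt0 A y : strictly_semi_positive A -> nonneg y -> y != 0 ->
  0 < max_prod A y.
Proof.
move=> hA y0 yn0; have [k [yk Ak]] := hA _ y0 yn0.
have [_ _ /(_ k)] := max_prod_attained A y (leq_ltn_trans (leq0n k) (ltn_ord k)).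
by apply: lt_le_trans; rewrite mulr_gt0.
Qed.

(* Strict semi-positivity bounds the set from below, so that [inf] is not a
   junk value. *)
Lemma beta_le A y : strictly_semi_positive A -> inf_sphere_nonneg y ->
  beta A <= max_prod A y.
Proof.
move=> hA yS; apply: ge_inf; last by exists y.
exists 0 => _ [z [z0 z1] <-]; apply/ltW/max_prod_gt0 => //.
by rewrite -normr_eq0 z1 oner_eq0.
Qed.

(** Normalise [y] to the unit sphere and take an index attaining the maximum there; each product is
    homogeneous of degree [m]. *)
Lemma beta_homogeneous_le A y : (0 < m)%N -> strictly_semi_positive A ->
  nonneg y -> y != 0 ->
  exists i, beta A * `|y| ^+ m <= y 0 i * tensor_app A y 0 i.
Proof.
move=> m0 hA y0 yn0; have ny : 0 < `|y| by rewrite normr_gt0.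
have n0 : (0 < n)%N by have [[i lin] _] := hA _ y0 yn0; exact: leq_ltn_trans lin.
have zS : inf_sphere_nonneg (`|y|^-1 *: y).
  split=> [i|]; first by rewrite mxE mulr_ge0 // invr_ge0 ltW.
  by rewrite normrZ ger0_norm ?invr_ge0 ?(ltW ny) // mulVf ?gt_eqF.
have := beta_le hA zS.
have [i -> _] := max_prod_attained A (`|y|^-1 *: y) n0 => le_i; exists i.
rewrite -ler_pdivlMr ?exprn_gt0 //; apply: (le_trans le_i).
by rewrite tensor_app_scale !mxE mulrACA -exprS prednK // exprVn mulrC.
Qed.

(** Common core of both cases: [e = m] for H-eigenvalues, [e = 2] for Z-eigenvalues. *)
Lemma beta_extend_zero A J (x : 'rV[R]_#|J|) (l : R) (e : nat) :
  (0 < m)%N -> strictly_semi_positive A -> nonneg x -> x != 0 ->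
  (forall k, x 0 k * tensor_app (principal_subtensor A J) x 0 k = l * x 0 k ^+ e) ->
  0 < l /\ beta A * `|extend_zero x| ^+ m <= l * `|extend_zero x| ^+ e.
Proof.
move=> m0 hA x0 xn0 Ax.
have l0 : 0 < l.
  have [k [xk Bk]] := strictly_semi_positive_sub hA x0 xn0.
  by have := mulr_gt0 xk Bk; rewrite Ax pmulr_lgt0 // exprn_gt0.
split=> //.
have [i le_i] := beta_homogeneous_le m0 hA (extend_zero_nonneg x0)
  (extend_zero_neq0 xn0).
apply: (le_trans le_i).
(* Positivity of [l] serves twice: outside [J] the product is 0, and inside [J] the bound
   [x 0 k <= |y|] survives multiplication by [l]. *)
have [->|[k ik ->]] := extend_zero_prod A x i.
  by rewrite mulr_ge0 ?exprn_ge0 // ltW.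
rewrite Ax ler_pM2l // lerXn2r ?nnegrE //.
by rewrite -extend_zero_in ler_norm_coord.
Qed.

Lemma beta_le_Hplus_eigenvalue A J (l : R) : (0 < m)%N ->
  strictly_semi_positive A ->
  Hplus_eigenvalue (principal_subtensor A J) l -> beta A <= l.
Proof.
move=> m0 hA [x [xn0 x0 Ax]].
have [k|_] := beta_extend_zero (l := l) (e := m) m0 hA x0 xn0.
  by rewrite Ax !mxE mulrCA -exprS prednK.
by rewrite ler_pM2r // exprn_gt0 // normr_gt0 extend_zero_neq0.
Qed.

(** The squares sum to 1, and there are [#|J| <= n] of them, each at most the squared max norm. *)
Lemma norm_extend_zero_ge J (x : 'rV[R]_#|J|) : nonneg x -> x *m x^T = 1%:M ->
  1 <= n%:R * `|extend_zero x| ^+ 2.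
Proof.
move=> x0 /matrixP/(_ 0 0); rewrite !mxE eqxx mulr1n => x1; rewrite -[leLHS]x1.
apply: (@le_trans _ _ (\sum_(k < #|J|) `|extend_zero x| ^+ 2)).
  apply: ler_sum => k _; rewrite mxE -expr2 lerXn2r ?nnegrE //.
  by rewrite -extend_zero_in ler_norm_coord.
rewrite sumr_const card_ord -[leLHS]mulr_natl ler_wpM2r ?sqr_ge0 ?ler_nat //.
by rewrite -[leqRHS](card_ord n) max_card.
Qed.

Lemma beta_le_Zplus_eigenvalue A J (l : R) (p : nat) : m = p.+1.*2 ->
  strictly_semi_positive A ->
  Zplus_eigenvalue (principal_subtensor A J) l -> beta A <= n%:R ^+ p * l.
Proof.
move=> mE hA [x [x0 x1 Ax]].
have xn0 : x != 0.
  apply: contra_eq_neq x1 => ->; rewrite mul0mx eq_sym.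
  by apply/eqP => /matrixP/(_ 0 0)/eqP; rewrite !mxE eqxx mulr1n oner_eq0.
have [||l0] := beta_extend_zero (l := l) (e := 2) _ hA x0 xn0.
- by rewrite mE.
- by move=> k; rewrite Ax !mxE mulrCA expr2.
set y := extend_zero x.
have y0 : 0 < `|y| by rewrite normr_gt0 extend_zero_neq0.
(* Write [|y|^m] as [|y|^2 * (|y|^2)^p] and cancel [|y|^2], leaving [beta A * (|y|^2)^p <= l]. *)
rewrite [X in _ ^+ X]mE -mul2n exprM exprS mulrCA [leRHS]mulrC.
rewrite ler_pM2l ?exprn_gt0 // => bl.
have ny : 1 <= (n%:R * `|y| ^+ 2) ^+ p.
  by rewrite exprn_ege1 // norm_extend_zero_ge.
(* After multiplying the goal by [(|y|^2)^p], it remains to see [l <= (n |y|^2)^p * l], which is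
   [ny] with [l > 0]. *)
rewrite -(@ler_pM2r _ ((`|y| ^+ 2) ^+ p)) ?exprn_gt0 //.
apply: (le_trans bl); rewrite mulrAC -exprMn.
by rewrite ler_peMl // ltW.
Qed.

End Tensors.

Theorem theorem3p9 (R : realType) (m n : nat) (hm : (2 <= m)%N) (hn : (1 <= n)%N)
    (A : tensor R m n) (hA : strictly_semi_positive A) :
  beta A <= delta_Hplus A /\
  (~~ odd m ->
     beta A <= (n%:R `^ ((m%:R - 2) / 2)) * delta_Zplus A).
Proof.
have m0 := ltnW hm; split=> [|m_even].
  have [J [_ /lambda_Hplus_attained hl] ->] := delta_Hplus_attained A hn.
  exact: beta_le_Hplus_eigenvalue hl.
have [J [_ /lambda_Zplus_attained hl] ->] := delta_Zplus_attained A hn.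
(* As [m >= 2], [m./2] is positive and its predecessor is genuine; it equals [(m - 2) / 2], so the
   real power becomes a natural one. *)
have mE : m = m./2.-1.+1.*2.
  by rewrite prednK ?half_gt0 // -[LHS]odd_double_half (negbTE m_even).
have -> : (m%:R - 2) / 2 = m./2.-1%:R :> R.
  rewrite {1}mE doubleS -addn2 natrD addrK -muln2 natrM mulfK //.
by rewrite powR_mulrn //; exact: beta_le_Zplus_eigenvalue hl.
Qed.
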